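(* Let $(J,\mathcal{B})$ be a set-algebra, let $\varphi:\mathcal{B}\to\mathbb{R}$ be a bounded submodular setfunction with $\varphi(\emptyset)=0$, and let $f,g\in\mathrm{Bd}(\mathcal{B})$. Then $\widehat\varphi(f+g)\le\widehat\varphi(f)+\widehat\varphi(g)$.
   Context: A set-algebra $(J,\mathcal{B})$ is a family of subsets of $J$ containing $\emptyset,J$, closed under complements and finite unions. For $f:J\to\mathbb{R}$ write $\{f\ge t\}=\{x\in J: f(x)\ge t\}$. $f$ is $\mathcal{B}$-measurable if for all real $s<t$ there is $A\in\mathcal{B}$ with $\{f\ge t\}\subseteq A\subseteq\{f\ge s\}$; $\mathrm{Bd}(\mathcal{B})$ is the space of bounded $\mathcal{B}$-measurable functions with norm $\|f\|=\sup_J|f|$. $\varphi$ is submodular if $\varphi(X\cup Y)+\varphi(X\cap Y)\le\varphi(X)+\varphi(Y)$ for $X,Y\in\mathcal{B}$, and increasing if $X\subseteq Y$ implies $\varphi(X)\le\varphi(Y)$. $\varphi$ has bounded variation if $\sum_{i=1}^n|\varphi(X_i)-\varphi(X_{i-1})|$ is bounded over all chains $\emptyset=X_0\subseteq\dots\subseteq X_n=J$ in $\mathcal{B}$ (bounded submodular setfunctions have bounded variation). Choquet extension: for increasing $\psi$ on $\mathcal{B}$ with $\psi(\emptyset)=0$, let $\psi^{ui}(X)=\inf\{\psi(Y):Y\in\mathcal{B},Y\supseteq X\}$ for $X\subseteq J$, set $\widehat\psi(f)=\int_0^\infty\psi^{ui}\{f\ge t\}\,dt$ for $f\in\mathrm{Bd}$,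 $f\ge0$, and $\widehat\psi(f)=\widehat\psi(f+c)-c\psi(J)$ for general $f\in\mathrm{Bd}$ and any $c\ge\|f\|$. For $\varphi$ of bounded variation with $\varphi(\emptyset)=0$, let $\mu(S)=\sup\sum_{i}\max(0,\varphi(X_i)-\varphi(X_{i-1}))$ and $\nu(S)=\sup\sum_i\max(0,\varphi(X_{i-1})-\varphi(X_i))$, suprema over chains $\emptyset=X_0\subseteq\dots\subseteq X_n=S$ in $\mathcal{B}$ (the canonical decomposition: $\mu,\nu$ are increasing, vanish at $\emptyset$, and $\varphi=\mu-\nu$), and define $\widehat\varphi=\widehat\mu-\widehat\nu$. *)

(* Defs.v *)
From mathcomp Require Import all_boot all_order all_algebra.
From mathcomp Require Import all_classical all_reals all_analysis.

Set Implicit Arguments.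
Unset Strict Implicit.
Unset Printing Implicit Defensive.

Import Order.TTheory GRing.Theory Num.Theory.

Local Open Scope classical_set_scope.
Local Open Scope ring_scope.

(* A setfunction on the set-algebra B is represented by a total function
   [set J -> R]; every definition below evaluates it on members of B only. *)
Section SetAlgebra.
Context {R : realType} {J : Type}.
Implicit Types (B : set (set J)) (phi psi : set J -> R) (f : J -> R).

Definition set_algebra B : Prop :=
  [/\ B set0, B setT, setC_closed B & setU_closed B].

Definition superlevel f (t : R) : set J := [set x | t <= f x].

Definition algebra_measurable B f : Prop :=
  forall s t : R, s < t ->
    exists A : set J,
      [/\ B A, superlevel f t `<=` A & A `<=` superlevel f s].

Definition bounded_function f : Prop := exists M : R, forall x, `|f x| <= M.

Definition Bd B : set (J -> R) :=
  [set f | bounded_function f /\ algebra_measurable B f].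

Definition sup_norm f : R := sup [set `|f x| | x in [set: J]].

Definition submodular B phi : Prop :=
  forall X Y : set J, B X -> B Y ->
    phi (X `|` Y) + phi (X `&` Y) <= phi X + phi Y.

Definition bounded_setfunction B phi : Prop :=
  exists M : R, forall X : set J, B X -> `|phi X| <= M.

(* psi^{ui} *)
Definition upper_ext B psi (X : set J) : R :=
  inf [set psi Y | Y in [set Y | B Y /\ X `<=` Y]].

Definition choquet_ge0 B psi f : R :=
  \int[lebesgue_measure]_(t in `[0, +oo[) upper_ext B psi (superlevel f t).

(* For psi increasing on B with psi set0 = 0 and f bounded, the value of
   [choquet_ge0 B psi (fun x => f x + c) - c * psi setT] is the same for every
   c >= sup_norm f, and equals [choquet_ge0 B psi f] if f >= 0 (translation
   invariance of the Lebesgue measure), so c = sup_norm f can be taken. *)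
Definition choquet_incr B psi f : R :=
  choquet_ge0 B psi (fun x => f x + sup_norm f) - sup_norm f * psi setT.

Definition chain B (S : set J) (n : nat) (X : nat -> set J) : Prop :=
  [/\ X 0%N = set0, X n = S,
      forall i, (i <= n)%N -> B (X i) &
      forall i, (i < n)%N -> X i `<=` X i.+1].

(* mu and nu of the canonical decomposition phi = mu - nu; the suprema are those
   of nonempty sets, bounded above when phi has bounded variation. *)
Definition pos_variation B phi (S : set J) : R :=
  sup [set v | exists n X, chain B S n X /\
         v = \sum_(i < n) Num.max 0 (phi (X i.+1) - phi (X i))].

Definition neg_variation B phi (S : set J) : R :=
  sup [set v | exists n X, chain B S n X /\
         v = \sum_(i < n) Num.max 0 (phi (X i) - phi (X i.+1))].

Definition choquet B phi f : R :=
  choquet_incr B (pos_variation B phi) f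
  - choquet_incr B (neg_variation B phi) f.

End SetAlgebra.

(* Main.v *)
(* Everything reduces to integer-valued B-simple functions N = sum_k 1_{N > k},
   whose Choquet integral is sum_k phi {N > k}. Adding one indicator 1_C to N
   replaces {N > k} by {N > k} `|` ({N >= k} `&` C); applying submodularity to
   these two sets for k = 0, 1, ... telescopes to the subadditivity inequality.
   A function of Bd(B) is uniformly within e of e N for such an N, and for
   increasing psi the integral of the nonincreasing t |-> psi^{ui} {f >= t} is
   within O(e) of e sum_k psi {N > k}, by comparison with its Riemann sums.
   Apply this to psi = mu and psi = nu and let e tend to 0. That phi = mu - nu
   rests on bounded variation: along a chain, the union Y of the differences
   on which phi grows satisfies phi Y >= the sum of the positive increments. *)

Require Import Defs.
From mathcomp Require Import all_boot all_order all_algebra.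
From mathcomp Require Import all_classical all_reals all_analysis.
From mathcomp Require Import measurable_realfun zify ring lra.

Import Order.TTheory GRing.Theory Num.Theory.

Local Open Scope classical_set_scope.
Local Open Scope ring_scope.

(** * Chains, positive variation and negative variation *)

Section Variation.
Context {R : realType} {J : Type}.
Variables (B : set (set J)).
Hypothesis algB : set_algebra B.
Implicit Types (phi psi : set J -> R) (S T Y : set J).

Lemma algebraI X Y : B X -> B Y -> B (X `&` Y).
Proof.
case: algB => _ _ BC BU BX BY.
by rewrite -(setCK (X `&` Y)) setCI; apply/BC/BU; exact: BC.
Qed.

Lemma algebraD X Y : B X -> B Y -> B (X `\` Y).
Proof.
by case: algB => _ _ BC _ BX BY; rewrite setDE; apply: algebraI => //; exact: BC.
Qed.

Definition increasing_on psi : Prop :=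
  forall X Y, B X -> B Y -> X `<=` Y -> psi X <= psi Y.

Definition pos_sum phi (X : nat -> set J) (n : nat) : R :=
  \sum_(i < n) Num.max 0 (phi (X i.+1) - phi (X i)).

Definition pos_variation_bounded phi : Prop :=
  exists M, forall S n X, chain B S n X -> pos_sum phi X n <= M.

Lemma pos_variationE phi S : pos_variation B phi S =
  sup [set v | exists n X, chain B S n X /\ v = pos_sum phi X n].
Proof. by []. Qed.

Lemma neg_variationE phi :
  neg_variation B phi = pos_variation B (fun X => - phi X).
Proof.
apply/funext => S; rewrite /neg_variation /pos_variation; congr sup.
apply/seteqP; split => v [n [X [cX ->]]]; exists n, X; split => //;
  by apply: eq_bigr => i _; rewrite opprK addrC.
Qed.

Lemma chain_mem S n X : chain B S n X -> B S.
Proof. by case=> _ <- BX _; exact: BX. Qed.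

Lemma pos_sum_ge0 phi X n : 0 <= pos_sum phi X n.
Proof. by apply: sumr_ge0 => i _; rewrite le_max lexx. Qed.

Lemma chain_le S T n X : chain B S n X -> B T -> S `<=` T ->
  chain B T n.+1 (fun i => if (i <= n)%N then X i else T).
Proof.
move=> [X0 Xn BX sX] BT ST; split.
- by rewrite leq0n.
- by rewrite ltnn.
- by move=> i _; case: ifP => // /BX.
- move=> i; rewrite ltnS => lein; rewrite lein.
  case: ltnP => [ltin|leni]; first exact: sX.
  by have -> : i = n by [lia]; rewrite Xn.
Qed.

Lemma chain_ex S : B S -> exists n X, chain B S n X.
Proof.
case: algB => B0 _ _ _ BS; have c0 : chain B set0 0 (fun=> set0) by split.
by exists 1%N, (fun i => if (i <= 0)%N then set0 else S); apply: chain_le c0 _ _.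
Qed.

Section IncreasingVariation.
Variable phi : set J -> R.
Hypothesis bphi : pos_variation_bounded phi.

Lemma has_sup_pos_variation S : B S ->
  has_sup [set v | exists n X, chain B S n X /\ v = pos_sum phi X n].
Proof.
move=> BS; split.
  by have [n [X cX]] := chain_ex S BS; exists (pos_sum phi X n), n, X.
by have [M bM] := bphi; exists M => _ [n [X [cX ->]]]; exact: bM cX.
Qed.

Lemma pos_sum_le_variation S n X : chain B S n X ->
  pos_sum phi X n <= pos_variation B phi S.
Proof.
move=> cX; rewrite pos_variationE; apply: sup_upper_bound.
  exact: has_sup_pos_variation (chain_mem _ _ _ cX).
by exists n, X.
Qed.

Lemma pos_variation_le S c : B S ->
  (forall n X, chain B S n X -> pos_sum phi X n <= c) ->
  pos_variation B phi S <= c.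
Proof.
move=> BS cub; rewrite pos_variationE; apply: ge_sup.
  by case: (has_sup_pos_variation S BS).
by move=> _ [n [X [cX ->]]]; exact: cub.
Qed.

(** A chain up to [S] becomes a chain up to [T] by appending [T], which adds one nonnegative term to
    its sum. *)
Lemma pos_variation_incr : increasing_on (pos_variation B phi).
Proof.
move=> S T BS BT ST; apply: pos_variation_le => // n X cX.
apply: le_trans (pos_sum_le_variation _ _ _ (chain_le _ _ _ _ cX BT ST)).
rewrite /pos_sum big_ord_recr /=.
apply: le_trans (_ : _ <= pos_sum phi X n + 0) _; first by rewrite addr0.
apply: lerD; last by rewrite le_max lexx.
by apply: ler_sum => i _; rewrite ltn_ord (ltnW (ltn_ord i)).
Qed.

Lemma pos_variation0 : pos_variation B phi set0 = 0.
Proof.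
have B0 : B set0 by case: algB.
apply/eqP; rewrite eq_le; apply/andP; split.
  apply: pos_variation_le => // n X [_ Xn _ sX].
  have X0 i : (i <= n)%N -> X i = set0.
    move=> lein; apply/seteqP; split => //; rewrite -Xn -(subnK lein).
    (* Induction on [k <= n - i] shows that [X i] is contained in [X (k + i)], so a chain ending in
       the empty set is constantly empty. *)
    have : (n - i <= n - i)%N by [].
    elim: {-2}(n - i)%N => [|k IH] kn //.
    apply: subset_trans (IH (ltnW kn)) _.
    by rewrite addSn; apply: sX; lia.
  rewrite /pos_sum big1// => i _.
  by rewrite !X0 ?subrr ?maxxx// ltnW.
have [n [X cX]] := chain_ex _ B0.
exact: le_trans (pos_sum_ge0 _ _ _) (pos_sum_le_variation _ _ _ cX).
Qed.

End IncreasingVariation.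

(** Each increment [d] satisfies [max 0 d - max 0 (- d) = d], and the increments telescope. *)
Lemma pos_sumN phi X n : pos_sum phi X n - pos_sum (fun Y => - phi Y) X n =
  phi (X n) - phi (X 0%N).
Proof.
elim: n => [|n IH]; first by rewrite /pos_sum !big_ord0 !subrr.
move: IH; rewrite /pos_sum !big_ord_recr /=.
by rewrite /Num.max; case: ifP; case: ifP; lra.
Qed.

(** * Bounded variation of bounded submodular set functions *)

Section SubmodularVariation.
Variable phi : set J -> R.
Hypothesis subphi : submodular B phi.
Hypothesis bphi : bounded_setfunction B phi.
Hypothesis phi0 : phi set0 = 0.

Lemma submodular_pos_sum_le S n X : chain B S n X ->
  exists Y, [/\ B Y, Y `<=` X n & pos_sum phi X n <= phi Y].
Proof.
case=> X0 _ BX sX.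
have : (n <= n)%N by [].
elim: {-2}n => [_|k IH kn].
  exists set0; split => //; first by case: algB.
  by rewrite /pos_sum big_ord0 phi0.
have [Y [BY YX leY]] := IH (ltnW kn).
have BXk : B (X k) by exact/BX/ltnW.
have BXk1 : B (X k.+1) by exact: BX.
move: leY; rewrite /pos_sum big_ord_recr /= => leY.
have [le0|gt0] := lerP (phi (X k.+1) - phi (X k)) 0.
  exists Y; split => //; first exact: subset_trans YX (sX _ kn).
  by rewrite addr0.
have BD := algebraD _ _ BXk1 BXk.
have BY' : B (Y `|` (X k.+1 `\` X k)) by case: algB => _ _ _; exact.
(* Since [Y] lies in [X k], the new set and [X k] have union [X k.+1] and intersection [Y].
   Submodularity thus makes [phi] gain at least the increment from [X k] to [X k.+1]. *)
exists (Y `|` (X k.+1 `\` X k)); split => //.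
  move=> x [/YX/(sX _ kn)//|[]//].
have := subphi _ _ BXk BY'.
have -> : X k `|` (Y `|` (X k.+1 `\` X k)) = X k.+1.
  apply/seteqP; split => x; first by move=> [/(sX _ kn)//|[/YX/(sX _ kn)//|[]//]].
  by move=> xX; have [xk|nxk] := pselect (X k x); [left|right; right].
have -> : X k `&` (Y `|` (X k.+1 `\` X k)) = Y.
  apply/seteqP; split => x; first by move=> [xk [//|[]//]].
  by move=> xY; split; [exact: YX|left].
lra.
Qed.

Lemma submodular_pos_variation_bounded : pos_variation_bounded phi.
Proof.
have [M bM] := bphi; exists M => S n X /submodular_pos_sum_le[Y [BY _ leY]].
exact: le_trans leY (le_trans (ler_norm _) (bM _ BY)).
Qed.

Lemma submodular_neg_variation_bounded :
  pos_variation_bounded (fun X => - phi X).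
Proof.
have [M bM] := bphi; have [M' bM'] := submodular_pos_variation_bounded.
exists (M' + M) => S n X cX; have := pos_sumN phi X n.
have := bM' _ _ _ cX; have := bM _ (chain_mem _ _ _ cX).
case: cX => -> -> _ _; rewrite phi0 ler_norml => /andP[]; lra.
Qed.

(** Along every chain up to [S] the positive and negative sums differ by the same constant [phi S],
    hence so do their suprema. *)
Lemma variation_decomposition S : B S ->
  phi S = pos_variation B phi S - neg_variation B phi S.
Proof.
rewrite neg_variationE => BS.
have diff n X : chain B S n X ->
    pos_sum phi X n - pos_sum (fun Y => - phi Y) X n = phi S.
  by case=> X0 Xn _ _; rewrite pos_sumN X0 Xn phi0 subr0.
have bp := submodular_pos_variation_bounded.
have bn := submodular_neg_variation_bounded.
apply/eqP; rewrite eq_le; apply/andP; split.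
  suff : pos_variation B (fun X => - phi X) S <= pos_variation B phi S - phi S.
    lra.
  apply: pos_variation_le => // n X cX.
  by have := pos_sum_le_variation _ bp _ _ _ cX; have := diff _ _ cX; lra.
suff : pos_variation B phi S <= pos_variation B (fun X => - phi X) S + phi S.
  lra.
apply: pos_variation_le => // n X cX.
by have := pos_sum_le_variation _ bn _ _ _ cX; have := diff _ _ cX; lra.
Qed.

End SubmodularVariation.

(** * Layers of integer-valued functions and subadditivity of layer sums *)

Definition layer (N : J -> nat) (k : nat) : set J := [set x | (k < N x)%N].

Definition simple_nat (N : J -> nat) : Prop := forall k, B (layer N k).

(** For [N <= n] and [psi set0 = 0] this is the Choquet integral of [N]: the layers from [n] on are
    empty. *)
Definition layer_sum psi (N : J -> nat) (n : nat) : R :=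
  \sum_(k < n) psi (layer N k).

Definition ind (C : set J) (x : J) : nat := `[< C x >].

Lemma layer_add_ind N C k :
  layer (fun x => N x + ind C x)%N k =
  layer N k `|` ([set x | (k <= N x)%N] `&` C).
Proof.
apply/seteqP; split => x; rewrite /layer /ind /=.
  case: asboolP => Cx; rewrite ?addn1 ?addn0 ?ltnS => kN; last by left.
  by right.
by move=> [kN|[kN Cx]]; [|rewrite asboolT//]; lia.
Qed.

Lemma simple_add_ind N C : simple_nat N -> B C ->
  simple_nat (fun x => N x + ind C x)%N.
Proof.
case: algB => _ BT _ BU sN BC k; rewrite layer_add_ind.
apply: BU => //; apply: algebraI => //.
case: k => [|k]; last exact: sN.
by rewrite (_ : [set x | _] = setT)//; apply/seteqP.
Qed.

Lemma layer_sum_add_ind phi N C n : submodular B phi -> simple_nat N -> B C ->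
  (forall x, (N x <= n)%N) ->
  layer_sum phi (fun x => N x + ind C x)%N n.+1 <= layer_sum phi N n + phi C.
Proof.
move=> subphi sN BC Nn.
pose carry k := [set x | (k <= N x)%N] `&` C.
have BN k : B [set x | (k <= N x)%N].
  case: k => [|k]; last exact: sN.
  by rewrite (_ : [set x | _] = setT); [case: algB|apply/seteqP].
(* Invariant of the telescoping: [carry 0] is [C], and submodularity on [layer N k] and [carry k]
   yields layer [k] of the new function as union and [carry k.+1] as intersection. *)
have step k : layer_sum phi (fun x => N x + ind C x)%N k + phi (carry k) <=
    layer_sum phi N k + phi C.
  elim: k => [|k IH].
    rewrite /layer_sum !big_ord0 !add0r (_ : carry 0%N = C)//.
    by apply/seteqP; split => // x [].
  move: IH; rewrite /layer_sum !big_ord_recr /= layer_add_ind -/(carry k).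
  have := subphi _ _ (sN k) (algebraI _ _ (BN k) BC).
  rewrite -/(carry k) (_ : layer N k `&` carry k = carry k.+1); first lra.
  apply/seteqP; split => x; rewrite /carry /layer /=; first by move=> [? []].
  by move=> [kN Cx]; split => //; split => //; exact: ltnW.
(* As [N <= n], layer [n] of [N] is empty, so the remaining [carry n] is exactly the top layer of
   the sum. *)
have := step n; rewrite /layer_sum big_ord_recr /=.
rewrite (_ : layer _ n = carry n)// layer_add_ind.
apply/seteqP; split => x; last by right.
by move=> [|//]; rewrite /layer /= ltnNge Nn.
Qed.

Lemma simple_add_min N M m : simple_nat N -> simple_nat M ->
  simple_nat (fun x => N x + minn (M x) m)%N.
Proof.
move=> sN sM; elim: m => [|m IH].
  by under eq_fun do rewrite minn0 addn0.
rewrite (_ : (fun x => _) = fun x => (N x + minn (M x) m + ind (layer M m) x)%N).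
  exact: simple_add_ind.
apply/funext => x; rewrite /ind /layer /= asboolb; lia.
Qed.

(** [M] is added one layer at a time: [minn (M x) m.+1] exceeds [minn (M x) m] by the indicator of
    [layer M m], so the induction runs on the truncation level. *)
Lemma layer_sum_add phi N M n m : submodular B phi ->
  simple_nat N -> simple_nat M ->
  (forall x, (N x <= n)%N) -> (forall x, (M x <= m)%N) ->
  layer_sum phi (fun x => N x + M x)%N (n + m) <=
  layer_sum phi N n + layer_sum phi M m.
Proof.
move=> subphi sN sM Nn Mm.
rewrite (_ : (fun x => _) = fun x => (N x + minn (M x) m)%N); last first.
  by apply/funext => x; rewrite (minn_idPl (Mm x)).
elim: m {Mm} => [|m IH].
  rewrite {3}/layer_sum big_ord0 addr0 addn0.
  by under eq_fun do rewrite minn0 addn0.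
rewrite (_ : (fun x => _) = fun x => (N x + minn (M x) m + ind (layer M m) x)%N).
  rewrite addnS; apply: le_trans (layer_sum_add_ind _ _ _ _ subphi _ (sM m) _) _.
  - exact: simple_add_min.
  - by move=> x; apply: leq_add => //; exact: geq_minr.
  - by rewrite [in leRHS]/layer_sum big_ord_recr /=; move: IH; rewrite /layer_sum; lra.
apply/funext => x; rewrite /ind /layer /= asboolb; lia.
Qed.

Lemma simple_add N M m : simple_nat N -> simple_nat M ->
  (forall x, (M x <= m)%N) -> simple_nat (fun x => N x + M x)%N.
Proof.
move=> sN sM Mm.
rewrite (_ : (fun x => _) = fun x => (N x + minn (M x) m)%N).
  exact: simple_add_min.
by apply/funext => x; rewrite (minn_idPl (Mm x)).
Qed.

End Variation.

(** * Riemann sums of a nonincreasing function *)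

Section RiemannSums.
Context {R : realType}.
Variables (G : R -> R) (e : R).
Hypothesis e_gt0 : 0 < e.
Hypothesis G_nincr : {homo G : s t /~ t <= s}.
Hypothesis G_ge0 : forall t, 0 <= G t.

Let mG (D : set R) : measurable D -> measurable_fun D (EFin \o G).
Proof. by move=> mD; apply/measurable_EFinP; exact: nonincreasing_measurable. Qed.

Let stepE k : k.+1%:R * e = k%:R * e + e.
Proof. by rewrite -addn1 natrD mulrDl mul1r. Qed.

Lemma integral_step_bounds k :
  ((e * G (k.+1%:R * e))%R%:E <=
   \int[lebesgue_measure]_(t in `[(k%:R * e)%R, (k.+1%:R * e)%R[) (G t)%:E <=
   (e * G (k%:R * e))%R%:E)%E.
Proof.
set D := (X in (integral _ X _)).
have mD : measurable D by exact: measurable_itv.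
have muD : lebesgue_measure D = e%:E.
  rewrite /D lebesgue_measure_itv /= lte_fin stepE ltrDl e_gt0.
  by rewrite -EFinB; congr EFin; ring.
apply/andP; split.
  rewrite mulrC EFinM -muD -integral_cst//.
  apply: ge0_le_integral => //.
  - by move=> t _; rewrite lee_fin.
  - exact: mG.
  - move=> t; rewrite /D /= in_itv /= => /andP[_ /ltW tk].
    by rewrite lee_fin; exact: G_nincr.
rewrite mulrC EFinM -muD -integral_cst//.
apply: ge0_le_integral => //.
- by move=> t _; rewrite lee_fin.
- exact: mG.
- move=> t; rewrite /D /= in_itv /= => /andP[kt _].
  by rewrite lee_fin; exact: G_nincr.
Qed.

Lemma integral_steps_bounds K :
  ((e * \sum_(k < K) G (k.+1%:R * e))%R%:E <=
   \int[lebesgue_measure]_(t in `[0%R, (K%:R * e)%R[) (G t)%:E <=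
   (e * \sum_(k < K) G (k%:R * e))%R%:E)%E.
Proof.
elim: K => [|K IH].
  by rewrite mul0r !big_ord0 mulr0 set_itvco0 integral_set0 lexx.
rewrite (@itv_bndbnd_setU _ _ _ (BLeft (K%:R * e))); last 2 first.
- by rewrite bnd_simp mulr_ge0 // ltW.
- by rewrite bnd_simp stepE lerDl ltW.
rewrite ge0_integral_setU//=; last 3 first.
- by apply: mG; exact: measurableU.
- by move=> t _; rewrite lee_fin.
- apply/disj_setPS => t []; rewrite /= !in_itv /= => /andP[_ tK] /andP[].
  by rewrite leNgt tK.
rewrite !big_ord_recr /= !mulrDr !EFinD.
have /andP[lo hi] := integral_step_bounds K; have /andP[Lo Hi] := IH.
by apply/andP; split; apply: leeD.
Qed.

Lemma Rintegral_bounds K : (forall t, K%:R * e <= t -> G t = 0) ->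
  e * \sum_(k < K) G (k.+1%:R * e) <=
  \int[lebesgue_measure]_(t in `[0, +oo[) G t <=
  e * \sum_(k < K) G (k%:R * e).
Proof.
move=> GK; rewrite /Rintegral.
rewrite (@itv_bndbnd_setU _ _ _ (BLeft (K%:R * e))); last 2 first.
- by rewrite bnd_simp mulr_ge0 // ltW.
- by rewrite bnd_simp.
rewrite ge0_integral_setU//=; last 3 first.
- by apply: mG; exact: measurableU.
- by move=> t _; rewrite lee_fin.
- apply/disj_setPS => t []; rewrite /= !in_itv /= => /andP[_ tK] /andP[].
  by rewrite leNgt tK.
rewrite [X in (_ + X)%E]integral0_eq ?adde0; last first.
  by move=> t; rewrite /= in_itv /= andbT => /GK ->.
have /andP[] := integral_steps_bounds K.
(* The real bounds exclude infinite values, so passing from the extended integral to its real part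
   loses nothing. *)
by case: (integral _ _ _) => [r| |]; rewrite ?lee_fin //= => -> ->.
Qed.

End RiemannSums.

Lemma le0_of_eps {R : realType} (x C : R) : 0 <= C ->
  (forall e, 0 < e -> x <= C * e) -> x <= 0.
Proof.
move=> C0 xC; rewrite leNgt; apply/negP => x0.
(* The test value is [e = x / (C + 1)]; adding 1 keeps the denominator positive when [C] is 0. *)
have C1 : 0 < C + 1 by lra.
have := xC _ (divr_gt0 x0 C1).
rewrite mulrA ler_pdivlMr// mulrDr mulr1 [C * x]mulrC; lra.
Qed.

Lemma ler_sum_widen {R : realType} (F : nat -> R) a b :
  (forall i, 0 <= F i) -> \sum_(i < a) F i <= \sum_(i < a + b) F i.
Proof. by move=> F0; rewrite big_split_ord /= lerDl sumr_ge0. Qed.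

Section Choquet.
Context {R : realType} {J : Type}.
Variables (B : set (set J)).
Hypothesis algB : set_algebra B.
Implicit Types (f g h : J -> R) (N : J -> nat).

(** * Upper extension of an increasing set function *)

Section UpperExtension.
Variable psi : set J -> R.
Hypothesis psi_incr : increasing_on B psi.
Hypothesis psi0 : psi set0 = 0.

Lemma increasing_ge0 X : B X -> 0 <= psi X.
Proof. by move=> BX; rewrite -psi0; apply: psi_incr => //; case: algB. Qed.

Lemma upper_ext_le X Y : B Y -> X `<=` Y -> upper_ext B psi X <= psi Y.
Proof.
move=> BY XY; apply: ge_inf; last by exists Y.
by exists 0 => _ [Z [BZ _] <-]; exact: increasing_ge0.
Qed.

(** [setT] is always a competitor, so the infimum is over a nonempty set. *)
Lemma le_upper_ext X c : (forall Y, B Y -> X `<=` Y -> c <= psi Y) ->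
  c <= upper_ext B psi X.
Proof.
move=> cle; apply: lb_le_inf; last by move=> _ [Y [BY XY] <-]; exact: cle.
by exists (psi setT), setT => //; split => //; case: algB.
Qed.

Lemma upper_ext_ge0 X : 0 <= upper_ext B psi X.
Proof. by apply: le_upper_ext => Y BY _; exact: increasing_ge0. Qed.

Lemma upper_ext_incr X Y : X `<=` Y -> upper_ext B psi X <= upper_ext B psi Y.
Proof.
move=> XY; apply: le_upper_ext => Z BZ YZ.
by apply: upper_ext_le => //; exact: subset_trans YZ.
Qed.

Lemma upper_ext0 : upper_ext B psi set0 = 0.
Proof.
apply/eqP; rewrite eq_le upper_ext_ge0 andbT -psi0.
by apply: upper_ext_le => //; case: algB.
Qed.

End UpperExtension.

(** * Approximation of Choquet integrals by layer sums *)

Definition simple_approx h (e : R) (m : nat) N n : Prop :=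
  [/\ simple_nat B N, forall x, (N x <= n)%N &
      forall x, `|h x - e * (N x)%:R| <= m%:R * e].

(** Superlevel sets of [h] on the grid of mesh [e] and layers of [N] contain each other up to an
    index shift of about [m]. The terms displaced by the shift are each at most [psi setT]. *)
Lemma choquet_ge0_approx psi h e m N n :
  increasing_on B psi -> psi set0 = 0 -> 0 < e -> simple_approx h e m N n ->
  `|choquet_ge0 B psi h - e * layer_sum psi N n| <= m.+1%:R * e * psi setT.
Proof.
move=> psi_incr psi0 e_gt0 [sN Nn hN].
pose G t := upper_ext B psi (superlevel h t).
have BT : B setT by case: algB.
have G_ge0 t : 0 <= G t by exact: upper_ext_ge0.
have G_nincr : {homo G : s t /~ t <= s}.
  move=> s t st; apply: upper_ext_incr => // x; exact: le_trans.
have GT t : G t <= psi setT by exact: upper_ext_le.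
have hub x : h x <= (N x + m)%:R * e.
  by have := hN x; rewrite ler_norml natrD => /andP[]; lra.
have hlb x : ((N x)%:R - m%:R) * e <= h x.
  by have := hN x; rewrite ler_norml => /andP[]; lra.
(* [h] is at most [(n + m) * e]; one more step is needed because superlevel sets are nonstrict. *)
have GK t : (m.+1 + n)%:R * e <= t -> G t = 0.
  move=> Kt; rewrite /G (_ : superlevel h t = set0) ?upper_ext0//.
  apply/seteqP; split => // x /= tx.
  have := le_trans Kt (le_trans tx (hub x)).
  rewrite ler_pM2r// ler_nat; have := Nn x; lia.
have G_layer k : G ((m.+1 + k)%:R * e) <= psi (layer N k).
  apply: upper_ext_le => // x /= kx; have := le_trans kx (hub x).
  by rewrite ler_pM2r// ler_nat /layer /=; lia.
have layer_G k : psi (layer N (m + k)%N) <= G (k.+1%:R * e).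
  apply: le_upper_ext => // Y BY hY; apply: psi_incr => // x /= kx; apply: hY.
  apply: le_trans (hlb x); rewrite ler_pM2r// lerBrDr -natrD ler_nat.
  by move: kx; rewrite /layer /=; lia.
have layer_ge0 k : 0 <= psi (layer N k) by exact: increasing_ge0.
have layerT k : psi (layer N k) <= psi setT by exact: psi_incr.
have /andP[lo hi] := Rintegral_bounds G e e_gt0 G_nincr G_ge0 _ GK.
(* The first [m.+1] samples of [G] are bounded by [psi setT], the others by [G_layer]. *)
have up : \sum_(k < m.+1 + n) G (k%:R * e) <=
    m.+1%:R * psi setT + layer_sum psi N n.
  rewrite big_split_ord /=; apply: lerD; last exact: ler_sum.
  apply: le_trans (_ : _ <= \sum_(i < m.+1) psi setT) _.
    by apply: ler_sum => i _; exact: GT.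
  by rewrite sumr_const card_ord mulr_natl.
(* Here the first [m] layers are bounded by [psi setT], the others by [layer_G]; nonnegative terms
   are appended to match the lengths. *)
have down : layer_sum psi N n <=
    m%:R * psi setT + \sum_(k < m.+1 + n) G (k.+1%:R * e).
  apply: le_trans (ler_sum_widen (fun k => psi (layer N k)) n m layer_ge0) _.
  rewrite addnC big_split_ord /=; apply: lerD.
    apply: le_trans (_ : _ <= \sum_(i < m) psi setT) _.
      by apply: ler_sum => i _; exact: layerT.
    by rewrite sumr_const card_ord mulr_natl.
  rewrite [(m.+1 + n)%N]addnC.
  apply: le_trans (ler_sum_widen (fun k => G (k.+1%:R * e)) n m.+1 _) => //.
  exact: ler_sum.
have {}up := ler_wpM2l (ltW e_gt0) up.
have {}down := ler_wpM2l (ltW e_gt0) down.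
have eT : 0 <= e * psi setT by apply: mulr_ge0; [exact: ltW|exact: increasing_ge0].
have mS : m.+1%:R = m%:R + 1 :> R by rewrite -addn1 natrD.
move: lo hi up down; rewrite mS ler_norml /choquet_ge0.
set I := Rintegral _ _ _ => lo hi up down.
by apply/andP; split; lra.
Qed.

(** The error factor [m] is the same for all [e], while [N] and its bound may vary with [e]; errors
    therefore vanish with [e]. *)
Definition approximable (m : nat) h : Prop :=
  forall e, 0 < e -> exists N n, simple_approx h e m N n.

Lemma simple_approx_add h1 h2 e m1 m2 N1 N2 n1 n2 :
  simple_approx h1 e m1 N1 n1 -> simple_approx h2 e m2 N2 n2 ->
  simple_approx (fun x => h1 x + h2 x) e (m1 + m2)
    (fun x => N1 x + N2 x)%N (n1 + n2)%N.
Proof.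
move=> [s1 N1n a1] [s2 N2n a2]; split.
- exact: simple_add s1 s2 N2n.
- by move=> x; exact: leq_add.
- move=> x; have := a1 x; have := a2 x; rewrite !ler_norml !natrD.
  by move=> /andP[? ?] /andP[? ?]; apply/andP; split; lra.
Qed.

Lemma approximable_add m1 m2 h1 h2 : approximable m1 h1 -> approximable m2 h2 ->
  approximable (m1 + m2) (fun x => h1 x + h2 x).
Proof.
move=> a1 a2 e e0; have [N1 [n1 aN1]] := a1 e e0.
have [N2 [n2 aN2]] := a2 e e0.
exists (fun x => N1 x + N2 x)%N, (n1 + n2)%N.
exact: simple_approx_add.
Qed.

Lemma truncn_divP (c e : R) : 0 <= c -> 0 < e ->
  exists k : nat, k%:R * e <= c <= k.+1%:R * e.
Proof.
move=> c0 e0; exists (Num.truncn (c / e)).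
have := truncn_itv (divr_ge0 c0 (ltW e0)).
by rewrite ler_pdivlMr// ltr_pdivrMr// => /andP[-> /ltW ->].
Qed.

(** Rounding [c] down to [k * e] costs one step. Truncation in [N x - k] is harmless: where
    [N x < k], the hypothesis [c <= h] places [h x - c] between 0 and [m * e]. *)
Lemma approximable_sub m h c : 0 <= c -> (forall x, c <= h x) ->
  approximable m h -> approximable m.+1 (fun x => h x - c).
Proof.
move=> c0 ch ah e e0; have [N [n [sN Nn hN]]] := ah e e0.
have [k /andP[kc ck]] := truncn_divP _ _ c0 e0.
exists (fun x => N x - k)%N, n; split.
- move=> j; rewrite (_ : layer _ _ = layer N (k + j)%N)//.
  by apply/seteqP; split => x; rewrite /layer /=; lia.
- by move=> x; have := Nn x; lia.
- move=> x; have := hN x; have := ch x; move: ck.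
  rewrite -!(addn1 k) -(addn1 m) !natrD !mulrDl !mul1r !ler_norml.
  move=> ck chx /andP[lo hi]; have [kN|Nk] := leqP k (N x).
    by rewrite natrB//; apply/andP; split; lra.
  rewrite (_ : (N x - k)%N = 0%N); last by lia.
  have : (N x)%:R * e <= k%:R * e by rewrite ler_pM2r// ler_nat ltnW.
  rewrite mulr0 => NK; have : 0 <= m%:R * e by rewrite mulr_ge0// ltW.
  by move=> ?; apply/andP; split; lra.
Qed.

(** Adding [k] to [N] inserts [k] layers equal to the whole space, worth [k%:R * psi setT], and
    [k * e] approximates [c]. *)
Lemma choquet_ge0_translate psi m h c :
  increasing_on B psi -> psi set0 = 0 -> 0 <= c -> approximable m h ->
  choquet_ge0 B psi (fun x => h x + c) = choquet_ge0 B psi h + c * psi setT.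
Proof.
move=> psi_incr psi0 c0 ah.
have BT : B setT by case: algB.
have psiT : 0 <= psi setT by exact: (increasing_ge0 psi).
suff : `|choquet_ge0 B psi (fun x => h x + c) -
         (choquet_ge0 B psi h + c * psi setT)| <= 0.
  by rewrite normr_le0 subr_eq0 => /eqP.
(* The three summands are the errors for [h], for [h + c], and for rounding [c] to a multiple of
   [e]. *)
apply: (@le0_of_eps _ _ ((m.+1 + m.+2 + 1)%:R * psi setT)).
  by rewrite mulr_ge0.
move=> e e0; have [N [n aN]] := ah e e0; have [sN Nn hN] := aN.
have [k /andP[kc ck]] := truncn_divP _ _ c0 e0.
have aNk : simple_approx (fun x => h x + c) e m.+1 (fun x => N x + k)%N (k + n)%N.
  split.
  - move=> j; have [jk|kj] := ltnP j k.
      rewrite (_ : layer _ _ = setT)//; apply/seteqP; split => // x _.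
      by rewrite /layer /=; lia.
    rewrite (_ : layer _ _ = layer N (j - k)%N)//.
    by apply/seteqP; split => x; rewrite /layer /=; lia.
  - by move=> x; have := Nn x; lia.
  - move=> x; have := hN x; move: ck.
    rewrite -(addn1 k) -(addn1 m) !natrD !mulrDl !mul1r mulrDr !ler_norml.
    by move=> ck /andP[lo hi]; apply/andP; split; lra.
have sumE : layer_sum psi (fun x => N x + k)%N (k + n)%N =
    k%:R * psi setT + layer_sum psi N n.
  rewrite /layer_sum big_split_ord /=; congr (_ + _).
    rewrite (eq_bigr (fun=> psi setT)) ?sumr_const ?card_ord ?mulr_natl//.
    move=> i _; congr psi; apply/seteqP; split => // x _.
    by rewrite /layer /=; have := ltn_ord i; lia.
  apply: eq_bigr => i _; congr psi.
  by apply/seteqP; split => x; rewrite /layer /=; lia.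
have := choquet_ge0_approx _ _ _ _ _ _ psi_incr psi0 e0 aN.
have := choquet_ge0_approx _ _ _ _ _ _ psi_incr psi0 e0 aNk.
have kcT := ler_wpM2r psiT kc; have ckT := ler_wpM2r psiT ck.
rewrite sumE; set I1 := choquet_ge0 _ _ _; set I2 := choquet_ge0 _ _ _.
have kS : k.+1%:R = k%:R + 1 :> R by rewrite -addn1 natrD.
have mS : m.+1%:R = m%:R + 1 :> R by rewrite -addn1 natrD.
have mSS : m.+2%:R = m%:R + 2 :> R by rewrite -addn2 natrD.
move: ckT; rewrite kS !natrD mSS mS => ckT.
rewrite !ler_norml => /andP[? ?] /andP[? ?]; apply/andP; split; lra.
Qed.

(** Measurability gives sets [A k] between [f + c >= k * e] and [f + c >= (k - 1) * e]; [N x] counts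
    those among [A 1], ..., [A n] that contain [x]. *)
Lemma Bd_approximable f c : Bd B f -> (forall x, 0 <= f x + c) ->
  approximable 1 (fun x => f x + c).
Proof.
move=> [[M fM] mf] fc0 e e0.
have BT : B setT by case: algB.
have {mf} /choice[A A_prop] : forall k : nat, exists A : set J,
    [/\ B A, superlevel f (k%:R * e - c) `<=` A &
        A `<=` superlevel f (k%:R * e - e - c)].
  by move=> k; apply: mf; lra.
(* For [j < k] the level [(k - 1) * e] is at least [j * e], so the sets are nested although chosen
   independently. *)
have A_decr j k : (j < k)%N -> A k `<=` A j.
  move=> jk x /(let: And3 _ _ h := A_prop k in h x) /= kx.
  have [_ + _] := A_prop j; apply; rewrite /superlevel /=.
  have : j.+1%:R * e <= k%:R * e by rewrite ler_pM2r// ler_nat.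
  by rewrite -addn1 natrD mulrDl mul1r; move: kx; rewrite /superlevel /=; lra.
pose n := Num.truncn ((`|M| + `|c|) / e).
have hn x : f x + c < n.+1%:R * e.
  have := truncnS_gt ((`|M| + `|c|) / e); rewrite ltr_pdivrMr//.
  apply: le_lt_trans; apply: lerD; last exact: ler_norm.
  exact: le_trans (ler_norm _) (le_trans (fM x) (ler_norm _)).
pose out x k := ~~ `[< A k.+1 x >].
(* The first index leaving the nested family; [find] returns [n] if there is none. *)
pose N x := find (out x) (iota 0 n).
have Nn x : (N x <= n)%N by rewrite -[leqRHS](size_iota 0); exact: find_size.
have N_in x k : (k < N x)%N -> A k.+1 x.
  move=> kN; have := before_find 0%N kN.
  by rewrite nth_iota ?add0n ?(leq_trans kN)// => /negbFE/asboolP.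
have N_out x : (N x < n)%N -> ~ A (N x).+1 x.
  move=> Nxn; have : has (out x) (iota 0 n) by rewrite has_find size_iota.
  by move=> /(nth_find 0%N); rewrite -/(N x) nth_iota// add0n => /asboolPn.
exists N, n; split => //.
- move=> k; have [kn|nk] := ltnP k n.
    rewrite (_ : layer N k = A k.+1); first by have [] := A_prop k.+1.
    apply/seteqP; split => x; first exact: N_in.
    move=> Ak; rewrite /layer /= ltnNge; apply/negP => Nk.
    apply: (N_out x); first exact: leq_ltn_trans kn.
    by move: Nk; rewrite leq_eqVlt => /predU1P[->//|Nk]; exact: A_decr Ak.
  rewrite (_ : layer N k = set0); first by case: algB.
  apply/seteqP; split => // x; rewrite /layer /=; have := Nn x; lia.
(* Membership in [A (N x)] bounds [f x + c] below, and non-membership in the next set bounds it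
   above; for [N x = n] the upper bound is the choice of [n]. *)
- move=> x; rewrite mul1r ler_norml; apply/andP; split.
    have [N0|] := posnP (N x); first by rewrite N0 mulr0; have := fc0 x; lra.
    move=> Npos; have NE : (N x).-1.+1 = N x by rewrite prednK.
    have : A (N x) x by rewrite -NE; apply: N_in; rewrite NE.
    by have [_ _ h] := A_prop (N x); move=> /h; rewrite /superlevel /=; lra.
  have : f x + c < (N x).+1%:R * e.
    have [Nxn|nN] := ltnP (N x) n.
      rewrite ltNge; apply/negP => le; apply: (N_out x Nxn).
      by have [_ h _] := A_prop (N x).+1; apply: h; rewrite /superlevel /=; lra.
    by rewrite (_ : N x = n)//; apply/eqP; rewrite eqn_leq Nn.
  by rewrite -addn1 natrD mulrDl mul1r; lra.
Qed.

Lemma le_sup_norm f x : bounded_function f -> `|f x| <= sup_norm f.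
Proof.
move=> [M fM]; apply: sup_upper_bound; last by exists x.
by split; [exists `|f x|, x|exists M => _ [y _ <-]].
Qed.

Lemma sup_norm_add f g : bounded_function f -> bounded_function g ->
  sup_norm (fun x => f x + g x) <= sup_norm f + sup_norm g.
Proof.
(* For empty [J] every norm is the supremum of the empty set, which is 0. *)
move=> bf bg; have [x|noJ] := pselect (inhabited J); last first.
  have E0 h : [set `|h x| | x in [set: J]] = set0 :> set R.
    by apply/seteqP; split => // y [x]; case: noJ.
  by rewrite /sup_norm !E0 sup0 addr0.
case: x => x; apply: ge_sup; first by exists `|f x + g x|, x.
move=> _ [y _ <-]; apply: le_trans (ler_normD _ _) _.
by apply: lerD; exact: le_sup_norm.
Qed.

Lemma sup_norm_shift_ge0 f x : bounded_function f -> 0 <= f x + sup_norm f.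
Proof. by move=> /(le_sup_norm f x); rewrite ler_norml => /andP[]; lra. Qed.

(** * Subadditivity for a submodular difference of increasing set functions *)

Section Submodular.
Variables phi mu nu : set J -> R.
Hypothesis subphi : submodular B phi.
Hypothesis mu_incr : increasing_on B mu.
Hypothesis nu_incr : increasing_on B nu.
Hypothesis mu0 : mu set0 = 0.
Hypothesis nu0 : nu set0 = 0.
Hypothesis phiE : forall X, B X -> phi X = mu X - nu X.

Lemma layer_sumB N n : simple_nat B N ->
  layer_sum phi N n = layer_sum mu N n - layer_sum nu N n.
Proof.
move=> sN; rewrite /layer_sum -sumrB; apply: eq_bigr => k _; exact: phiE.
Qed.

Lemma choquet_ge0_subadditive m1 m2 f g : approximable m1 f -> approximable m2 g ->
  choquet_ge0 B mu (fun x => f x + g x) - choquet_ge0 B nu (fun x => f x + g x) <=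
  choquet_ge0 B mu f - choquet_ge0 B nu f +
  (choquet_ge0 B mu g - choquet_ge0 B nu g).
Proof.
move=> af ag; rewrite -subr_le0.
have BT : B setT by case: algB.
have muT : 0 <= mu setT by exact: (increasing_ge0 mu).
have nuT : 0 <= nu setT by exact: (increasing_ge0 nu).
(* The factors are the errors for [f], [g] and [f + g], each incurred once for [mu] and once for
   [nu]. *)
apply: (@le0_of_eps _ _
  ((m1.+1 + m2.+1 + (m1 + m2).+1)%:R * (mu setT + nu setT))).
  by rewrite mulr_ge0// addr_ge0.
move=> e e0; have [N [n aN]] := af e e0; have [M [m aM]] := ag e e0.
have [sN Nn _] := aN; have [sM Mm _] := aM.
have aNM := simple_approx_add _ _ _ _ _ _ _ _ _ aN aM; have [sNM _ _] := aNM.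
have := ler_wpM2l (ltW e0) (layer_sum_add _ algB _ _ _ _ _ subphi sN sM Nn Mm).
rewrite !layer_sumB//.
have := choquet_ge0_approx _ _ _ _ _ _ mu_incr mu0 e0 aN.
have := choquet_ge0_approx _ _ _ _ _ _ nu_incr nu0 e0 aN.
have := choquet_ge0_approx _ _ _ _ _ _ mu_incr mu0 e0 aM.
have := choquet_ge0_approx _ _ _ _ _ _ nu_incr nu0 e0 aM.
have := choquet_ge0_approx _ _ _ _ _ _ mu_incr mu0 e0 aNM.
have := choquet_ge0_approx _ _ _ _ _ _ nu_incr nu0 e0 aNM.
rewrite !ler_norml !natrD.
move=> /andP[? ?] /andP[? ?] /andP[? ?] /andP[? ?] /andP[? ?] /andP[? ?] ?.
lra.
Qed.

(** The shift by [sup_norm] of the sum may be smaller than the sum of the two shifts. Translation by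
    the nonnegative gap [c] reconciles them, and the multiples of [mu setT] and [nu setT] cancel. *)
Lemma choquet_incr_subadditive f g : Bd B f -> Bd B g ->
  choquet_incr B mu (fun x => f x + g x) - choquet_incr B nu (fun x => f x + g x)
  <= choquet_incr B mu f - choquet_incr B nu f +
     (choquet_incr B mu g - choquet_incr B nu g).
Proof.
move=> Bf Bg; have [[bf _] [bg _]] := (Bf, Bg).
have bfg : bounded_function (fun x => f x + g x).
  have [Mf hf] := bf; have [Mg hg] := bg; exists (Mf + Mg) => x.
  by apply: le_trans (ler_normD _ _) _; exact: lerD.
pose f' x := f x + sup_norm f; pose g' x := g x + sup_norm g.
pose s := sup_norm (fun x => f x + g x).
pose c := sup_norm f + sup_norm g - s.
have af : approximable 1 f'.
  by apply: Bd_approximable => // x; exact: sup_norm_shift_ge0.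
have ag : approximable 1 g'.
  by apply: Bd_approximable => // x; exact: sup_norm_shift_ge0.
have c0 : 0 <= c by rewrite subr_ge0; exact: sup_norm_add.
(* One step of error each for [f'] and [g'], and one for subtracting [c]. *)
have ah : approximable 3 (fun x => f' x + g' x - c).
  apply: approximable_sub => //; last exact: approximable_add 1 1 _ _ af ag.
  move=> x; have := sup_norm_shift_ge0 _ x bfg.
  by rewrite -/s /c /f' /g'; lra.
have shiftE : (fun x => f' x + g' x - c) = (fun x => f x + g x + s).
  by apply/funext => x; rewrite /f' /g' /c; ring.
have unshiftE : (fun x => f' x + g' x - c + c) = (fun x => f' x + g' x).
  by apply/funext => x; rewrite subrK.
have := choquet_ge0_translate _ _ _ _ mu_incr mu0 c0 ah.
have := choquet_ge0_translate _ _ _ _ nu_incr nu0 c0 ah.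
have := choquet_ge0_subadditive _ _ _ _ af ag.
rewrite unshiftE shiftE /choquet_incr -/s -/f' -/g'.
by move=> sub nuE muE; move: sub; rewrite muE nuE /c; lra.
Qed.

End Submodular.

End Choquet.

Theorem theorem3p1 (R : realType) (J : Type) (B : set (set J))
    (phi : set J -> R) (f g : J -> R) :
  set_algebra B ->
  bounded_setfunction B phi ->
  submodular B phi ->
  phi set0 = 0 ->
  Bd B f ->
  Bd B g ->
  choquet B phi (fun x => f x + g x) <= choquet B phi f + choquet B phi g.
Proof.
move=> algB bphi subphi phi0 Bf Bg.
have bp := submodular_pos_variation_bounded _ algB _ subphi bphi phi0.
have bn := submodular_neg_variation_bounded _ algB _ subphi bphi phi0.
rewrite /choquet; apply: (@choquet_incr_subadditive _ _ _ algB phi) => //.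
- exact: pos_variation_incr.
- by rewrite neg_variationE; exact: pos_variation_incr.
- exact: pos_variation0.
- by rewrite neg_variationE; exact: pos_variation0.
- exact: variation_decomposition.
Qed.
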